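(* Let $R\in\bar S$. The necessary and sufficient condition that $g(I)$ is integrable over $R$ with respect to $F$, i.e. that $(F)\int_R g(I)$ exists, is that for each pair of Riemann successions $\{D_n\},\{D_n'\}$ in $F$ of divisions of $R$, and given $\varepsilon>0$, there is an $n_0=n_0(\varepsilon;\{D_n\};\{D_n'\})$ such that for all $m,n>n_0$, $$\left|(R;D_m)\sum g(I)-(R;D_n')\sum g(I)\right|<\varepsilon .$$
   Context: Fix a closed interval $W$ of the real line. An interval is any open, closed or half-closed non-degenerate interval contained in $W$. Two intervals (or sets) overlap if they have a non-degenerate interval in common. An $I^\sigma$ is a finite union of intervals. $E'$ is the derived set of $E$. $S$ is a fixed non-empty set of intervals and $g:S\to\mathbb R$. $\bar S$ is the collection of all $I^\sigma$ which are finite unions of points of $W$ and interiors of intervals of $S$. A division $D$ of an $I^\sigma$ $R$ is a finite set of pairwise non-overlapping intervals of $S$ (each with its own end-point brackets), the union of whose closures is $R'$; norm$(D)$ is the greatest length of its intervals; $(R;D)\sum g(I)$ is the sum of $g(I)$ over the intervals of $D$. A Riemann succession of divisions of $R$ is a sequence $\{D_n\}$ of divisions of $R$ with norm$(D_n)\to0$. $F$ is a family of Riemann successions of divisions of sets $R\in\bar S$ satisfying: (i) for every $R\in\bar S$ there is at least one Riemann succession of divisions of $R$ in $F$; (ii) if $\{D_n\}\in F$ and $n_i\to\infty$ are integers, then $\{D_{n_i}\}\in F$; (iii) if $R_1,R_2\in\bar S$ are non-overlapping and $\{D_{1,n}\},\{D_{2,n}\}\in F$ are over $R_1,R_2$,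 then $\{D_{1,n}+D_{2,n}\}\in F$, where $D_{1,n}+D_{2,n}$ consists of the intervals of both divisions. $(F)\overline{\int}_R g$ is the supremum of $\overline{\lim}_n(R;D_n)\sum g(I)$, and $(F)\underline{\int}_R g$ the infimum of $\underline{\lim}_n(R;D_n)\sum g(I)$, over all $\{D_n\}\in F$ of divisions of $R$. $(F)\int_R g(I)$ exists if these are finite and equal, and is then their common value. *)

(* Defs.v *)
From mathcomp Require Import all_boot all_order all_algebra finmap.
From mathcomp Require Import all_classical all_reals all_analysis.

Set Implicit Arguments.
Unset Strict Implicit.
Unset Printing Implicit Defensive.

Import Order.TTheory GRing.Theory Num.Theory.
Import numFieldNormedType.Exports.

Local Open Scope fset_scope.
Local Open Scope classical_set_scope.
Local Open Scope ring_scope.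

Section Defs.
Variable R : realType.

(* The fixed closed interval W is `[a, b].  A value of [interval R] records the
   end-points together with their brackets, and for the non-degenerate ones it
   is determined by its set of points [set` I].  The interval function g is
   total here, but only its values on S are ever used. *)
Definition nondegenerate (I : interval R) : bool :=
  match I with
  | Interval (BSide _ x) (BSide _ y) => x < y
  | _ => false
  end.

Definition itv_length (I : interval R) : R :=
  match I with
  | Interval (BSide _ x) (BSide _ y) => y - x
  | _ => 0
  end.

Definition intervals (a b : R) : set (interval R) :=
  [set I | nondegenerate I /\ [set` I] `<=` `[a, b]].

Definition overlap (a b : R) (A B : set R) : Prop :=
  exists2 I, intervals a b I & [set` I] `<=` A `&` B.

(* The union may be empty: the empty set is an I^sigma. *)
Definition Isigma (a b : R) (E : set R) : Prop :=
  exists2 J : {fset interval R},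
    (forall I, I \in J -> intervals a b I) &
    E = \bigcup_(I in [set` J]) [set` I].

Definition Sbar (a b : R) (S : set (interval R)) : set (set R) :=
  [set E | Isigma a b E /\
    exists (P : {fset R}) (J : {fset interval R}),
      [/\ [set` P] `<=` `[a, b],
          [set` J] `<=` S &
          E = [set` P] `|` \bigcup_(I in [set` J]) interior [set` I] ] ].

(* The union of the closures is the derived set E' of E. *)
Definition division (a b : R) (S : set (interval R)) (E : set R)
    (D : {fset interval R}) : Prop :=
  [/\ [set` D] `<=` S,
      (forall I J, I \in D -> J \in D -> I != J ->
         ~ overlap a b [set` I] [set` J]) &
      \bigcup_(I in [set` D]) closure [set` I] = limit_point E].

Definition division_norm (D : {fset interval R}) : R :=
  \big[Num.max/0]_(I <- D) itv_length I.

Definition division_sum (g : interval R -> R) (D : {fset interval R}) : R :=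
  \sum_(I <- D) g I.

Definition riemann_succession (a b : R) (S : set (interval R)) (E : set R)
    (D : nat -> {fset interval R}) : Prop :=
  (forall n, division a b S E (D n)) /\
  (division_norm (D n) @[n --> \oo] --> (0 : R)).

(* A succession does not carry the set it divides: "{D_n} in F is over E" reads
   [F D] and [riemann_succession a b S E D].  The integers n_i = [k i] are only
   required to tend to infinity, not to increase. *)
Definition riemann_family (a b : R) (S : set (interval R))
    (F : set (nat -> {fset interval R})) : Prop :=
  [/\ forall D, F D -> exists2 E, Sbar a b S E & riemann_succession a b S E D,
      forall E, Sbar a b S E -> exists2 D, F D & riemann_succession a b S E D,
      forall (D : nat -> {fset interval R}) (k : nat -> nat),
        F D -> (k n @[n --> \oo] --> \oo) -> F (fun n => D (k n)) &
      forall E1 E2 D1 D2, Sbar a b S E1 -> Sbar a b S E2 ->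
        ~ overlap a b E1 E2 ->
        F D1 -> riemann_succession a b S E1 D1 ->
        F D2 -> riemann_succession a b S E2 D2 ->
        F (fun n => D1 n `|` D2 n)%fset].

Definition upper_integral (a b : R) (S : set (interval R))
    (F : set (nat -> {fset interval R})) (E : set R) (g : interval R -> R) :
    \bar R :=
  ereal_sup [set limn_esup (fun n => (division_sum g (D n))%:E) |
             D in [set D | F D /\ riemann_succession a b S E D]].

Definition lower_integral (a b : R) (S : set (interval R))
    (F : set (nat -> {fset interval R})) (E : set R) (g : interval R -> R) :
    \bar R :=
  ereal_inf [set limn_einf (fun n => (division_sum g (D n))%:E) |
             D in [set D | F D /\ riemann_succession a b S E D]].

(* (F) int_E g exists and equals v: the two integrals are finite and equal. *)
Definition integral_is (a b : R) (S : set (interval R))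
    (F : set (nat -> {fset interval R})) (E : set R) (g : interval R -> R)
    (v : R) : Prop :=
  upper_integral a b S F E g = v%:E /\ lower_integral a b S F E g = v%:E.

Definition integrable_wrt (a b : R) (S : set (interval R))
    (F : set (nat -> {fset interval R})) (E : set R) (g : interval R -> R) :
    Prop :=
  exists v : R, integral_is a b S F E g v.

End Defs.

(* Main.v *)
Require Import Defs.
From mathcomp Require Import all_boot all_order all_algebra finmap.
From mathcomp Require Import all_classical all_reals all_analysis.

Import Order.TTheory GRing.Theory Num.Theory.
Import numFieldNormedType.Exports.

Local Open Scope fset_scope.
Local Open Scope classical_set_scope.
Local Open Scope ring_scope.

(** The integral over [E] exists with value [v] exactly when the sums of [g]
    along every succession of [F] over [E] converge to the same number [v]:
    since the supremum of the upper limits is [v] and the infimum of the lower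
    limits is [v], each succession has its lower and upper limits squeezed
    between [v] and [v] (lemma [integral_isP]).  So the theorem compares two
    ways of saying that all these real sequences have one common limit.  A
    common limit gives the condition by the triangle inequality.  Conversely,
    the family contains at least one succession over [E]; the condition for
    that succession paired with itself says that its sums form a Cauchy
    sequence, and paired with any other succession it carries the limit
    over. *)

(** The sequence lies between the infima and the suprema of its tails, which
    converge to its lower and upper limits. *)
Lemma cvg_limn_einf_esup (R : realType) (u : nat -> \bar R) (l : \bar R) :
  (l <= limn_einf u)%E -> (limn_esup u <= l)%E -> u @ \oo --> l.
Proof.
move=> l_einf esup_l.
have einf_esup := limn_einf_sup u.
have einfE : limn_einf u = l.
  by apply/le_anti; rewrite l_einf (le_trans einf_esup esup_l).
have esupE : limn_esup u = l.
  by apply/le_anti; rewrite esup_l (le_trans l_einf einf_esup).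
apply: (@squeeze_cvge _ _ _ _ (einfs u) u (esups u)).
- apply: nearW => n; apply/andP; split.
    by apply: ereal_inf_lbound; exists n => /=.
  by apply: ereal_sup_ubound; exists n => /=.
- by rewrite -einfE limn_einf_lim; exact: is_cvg_einfs.
- by rewrite -esupE limn_esup_lim; exact: is_cvg_esups.
Qed.

(** Some succession over [E] is required: over an empty set of successions all
    sequences converge to [v], but the upper integral is minus infinity. *)
Lemma integral_isP (R : realType) (a b : R) (S : set (interval R))
    (F : set (nat -> {fset interval R})) (E : set R) (g : interval R -> R)
    (v : R) :
  (exists2 D, F D & riemann_succession a b S E D) ->
  integral_is a b S F E g v <->
  (forall D, F D -> riemann_succession a b S E D ->
     division_sum g (D n) @[n --> \oo] --> v).
Proof.
move=> [D0 FD0 D0E]; split=> [[upE loE] D FD DE | cvg_sums].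
  have /fine_cvgP[_] : (division_sum g (D n))%:E @[n --> \oo] --> v%:E.
    apply: cvg_limn_einf_esup.
      by rewrite -loE; apply: ereal_inf_lbound; exists D.
    by rewrite -upE; apply: ereal_sup_ubound; exists D.
  exact.
have limE D : F D -> riemann_succession a b S E D ->
    (limn_einf (fun n => (division_sum g (D n))%:E) = v%:E) *
    (limn_esup (fun n => (division_sum g (D n))%:E) = v%:E).
  move=> FD DE; apply: cvg_limn_einf_sup.
  by apply: cvg_EFin; [exact: nearW | exact: cvg_sums].
split.
- rewrite /upper_integral (_ : [set _ | _ in _] = [set v%:E]) ?ereal_sup1//.
  apply/seteqP; split=> [_ [D [FD DE] <-] | _ ->] /=; first by rewrite limE.
  by exists D0 => //; rewrite limE.
- rewrite /lower_integral (_ : [set _ | _ in _] = [set v%:E]) ?ereal_inf1//.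
  apply/seteqP; split=> [_ [D [FD DE] <-] | _ ->] /=; first by rewrite limE.
  by exists D0 => //; rewrite limE.
Qed.

Lemma near_pair_cvgn (R : realType) (u w : nat -> R) (v : R) :
  u @ \oo --> v -> w @ \oo --> v ->
  forall eps : R, 0 < eps ->
    exists n0 : nat, forall m n : nat, (n0 < m)%N -> (n0 < n)%N ->
      `|u m - w n| < eps.
Proof.
move=> /cvgrPdistC_lt uv /cvgrPdist_lt wv eps eps0.
have eps20 : 0 < eps / 2 by rewrite divr_gt0.
have [n1 _ un1] := uv _ eps20; have [n2 _ wn2] := wv _ eps20.
exists (maxn n1 n2) => m n; rewrite !gtn_max => /andP[n1m _] /andP[_ n2n].
rewrite (splitr eps) -(subrKA v) (le_lt_trans (ler_normD _ _))// ltrD//.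
  by apply: un1; exact: ltnW.
by apply: wn2; exact: ltnW.
Qed.

Lemma cvgn_near_self (R : realType) (u : nat -> R) :
  (forall eps : R, 0 < eps ->
    exists n0 : nat, forall m n : nat, (n0 < m)%N -> (n0 < n)%N ->
      `|u m - u n| < eps) ->
  cvgn u.
Proof.
move=> cauchy_u; apply: R_complete; apply: cauchy_exP => eps eps0.
have [n0 near_u] := cauchy_u _ eps0; exists (u n0.+1).
by exists n0.+1 => // n /= n0n; apply: near_u.
Qed.

Lemma cvgn_near_pair (R : realType) (u w : nat -> R) (v : R) :
  (forall eps : R, 0 < eps ->
    exists n0 : nat, forall m n : nat, (n0 < m)%N -> (n0 < n)%N ->
      `|u m - w n| < eps) ->
  u @ \oo --> v -> w @ \oo --> v.
Proof.
move=> near_uw uv; apply: cvg_sub0 uv.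
apply/cvgrPdist_lt => eps eps0; have [n0 near_n0] := near_uw _ eps0.
exists n0.+1 => // n /= n0n; rewrite sub0r normrN distrC.
exact: near_n0.
Qed.

Theorem mainTheorem10 (R : realType) (a b : R) (hW : a < b)
  (S : set (interval R)) (hS : S `<=` intervals a b) (hS0 : S !=set0)
  (g : interval R -> R)
  (F : set (nat -> {fset interval R})) (hF : riemann_family a b S F)
  (E : set R) (hE : Sbar a b S E) :
  integrable_wrt a b S F E g <->
  (forall D D' : nat -> {fset interval R},
     F D -> riemann_succession a b S E D ->
     F D' -> riemann_succession a b S E D' ->
     forall eps : R, 0 < eps ->
       exists n0 : nat, forall m n : nat, (n0 < m)%N -> (n0 < n)%N ->
         `|division_sum g (D m) - division_sum g (D' n)| < eps).
Proof.
have [_ /(_ _ hE)[D0 FD0 D0E] _ _] := hF.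
have succE : exists2 D, F D & riemann_succession a b S E D by exists D0.
split=> [[v /(integral_isP _ _ _ _ _ _ _ _ succE) cvg_sums] | near_sums].
  move=> D D' FD DE FD' D'E.
  by apply: near_pair_cvgn; [exact: cvg_sums | exact: cvg_sums].
have /cvg_ex[v D0v] : cvgn (fun n => division_sum g (D0 n)).
  by apply: cvgn_near_self; exact: near_sums.
exists v; apply/integral_isP => // D FD DE.
by apply: cvgn_near_pair D0v; exact: near_sums.
Qed.
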